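(* Assume that the metric space $X$ is bounded and doubling, and that $0<\mu(B)<\infty$ for all balls $B$ in $X$. Then the embedding $M^{\alpha,p}(X,\mu)\hookrightarrow L^p(X,\mu)$ is compact for all $1\le p<\infty$ and $\alpha>0$. In particular, if $\mu$ is not a finite sum of atoms, then $M^{\alpha,p}(X,\mu)\neq L^p(X,\mu)$.
   Context: $(X,d)$ is a metric space equipped with a positive complete Borel measure $\mu$. $X$ is doubling if there is $M$ such that every ball of radius $r$ can be covered by at most $M$ balls of radius $r/2$, with $M$ independent of $r$ (and of the ball). The measure $\mu$ is not assumed to be doubling. A nonnegative Borel function $g$ is a Haj\l asz $\alpha$-gradient of $u:X\to\mathbf{R}$ if for $\mu$-a.e. $x,y\in X$, $|u(x)-u(y)|\le d(x,y)^\alpha(g(x)+g(y))$. The Haj\l asz space $M^{\alpha,p}(X,\mu)$ consists of all $u\in L^p(X,\mu)$ having a Haj\l asz $\alpha$-gradient $g\in L^p(X,\mu)$, with norm $\|u\|_{M^{\alpha,p}(X,\mu)}=\|u\|_{L^p(X,\mu)}+\inf_g\|g\|_{L^p(X,\mu)}$, where the infimum is over all Haj\l asz $\alpha$-gradients $g$ of $u$. An embedding is compact if every bounded sequence in the domain space has a subsequence converging in the target space. ''$\mu$ is a finite sum of atoms'' means that, up to a $\mu$-null set, $X$ is a finite union of $\mu$-atoms. *)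

(* Defs.v *)
From HB Require Import structures.
From mathcomp Require Import all_boot all_order all_algebra.
From mathcomp Require Import all_classical all_reals all_analysis.

Set Implicit Arguments.
Unset Strict Implicit.
Unset Printing Implicit Defensive.

Import Order.TTheory GRing.Theory Num.Theory.
Import numFieldNormedType.Exports.

Local Open Scope classical_set_scope.
Local Open Scope ring_scope.

(* A set carrying both a metric and a sigma-algebra; no compatibility between
   the two is built in (see [borel_measurable]). *)
#[short(type="measurableMetricType")]
HB.structure Definition MeasurableMetric (d : measure_display)
    (R : numDomainType) :=
  {X of Metric R X & Measurable d X}.

Section metric_measure.
Context {R : realType} {d : measure_display} (X : measurableMetricType d R).

(* The Borel sets of X are measurable. The sigma-algebra may be larger, which is
   what makes room for complete measures. *)
Definition borel_measurable := <<s @open X >> `<=` @measurable d X.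

Definition metric_bounded := exists D : R, forall x y : X, mdist x y <= D.

Definition doubling := exists M : nat, forall (x : X) (r : R), 0 < r ->
  exists s : seq X, (size s <= M)%N /\
    ball x r `<=` \bigcup_(c in [set` s]) ball c (r / 2).

Variable mu : {measure set X -> \bar R}.

Definition atom (A : set X) := [/\ measurable A, (0 < mu A)%E &
  forall B, measurable B -> B `<=` A -> (mu B < mu A)%E -> mu B = 0%E].

Definition finite_sum_of_atoms := exists (n : nat) (A : 'I_n -> set X),
  (forall i, atom (A i)) /\ mu.-negligible (~` \bigcup_i A i).

(* "For mu-a.e. x, y" is read as: for all x, y outside a common mu-null set. *)
Definition hajlasz_gradient (a : R) (u g : X -> R) :=
  [/\ forall x, 0 <= g x,
      measurable_fun setT (g : g_sigma_algebraType (@open X) -> R) &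
      exists N : set X, mu.-negligible N /\
        forall x y, ~ N x -> ~ N y ->
          `|u x - u y| <= mdist x y `^ a * (g x + g y)].

(* Function spaces are sets of everywhere defined functions. Membership and
   norms are invariant under a.e. equality when mu is complete. *)
Definition Lp_space (p : R) : set (X -> R) := [set` Lfun mu p%:E].

Definition Lp_norm (p : R) (u : X -> R) : \bar R :=
  ('N[mu]_(p%:E)[EFin \o u])%E.

Definition hajlasz_space (a p : R) : set (X -> R) :=
  [set u | Lp_space p u /\ exists g, hajlasz_gradient a u g /\ Lp_space p g].

Definition hajlasz_norm (a p : R) (u : X -> R) : \bar R :=
  (Lp_norm p u +
   ereal_inf [set Lp_norm p g | g in [set g | hajlasz_gradient a u g]])%E.

End metric_measure.

Definition compact_embedding {R : realType} {V : zmodType}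
    (E : set V) (normE : V -> \bar R) (F : set V) (normF : V -> \bar R) :=
  E `<=` F /\
  forall u : nat -> V, (forall n, E (u n)) ->
    (exists C : R, forall n, (normE (u n) <= C%:E)%E) ->
    exists phi : nat -> nat, {homo phi : m n / (m < n)%N} /\
      exists2 v : V, F v &
        normF (u (phi n) - v) @[n --> \oo] --> 0%E.

(* Main.v *)
(* Cut X into finitely many measurable pieces of diameter at most rho.

   Compactness: on a piece A, a Chebyshev argument gives a point y at which
   |u|^p + g^p is at most its mean over A plus 1, and the gradient inequality
   then bounds the L^p distance on A from u to the constant u(y) by
   O(rho^a) times quantities controlled by the Hajlasz norm.  Hence a bounded
   sequence is, up to a uniformly small error, determined by finitely many
   bounded real sequences, and a subsequence is Cauchy in L^p.

   Strict inclusion: if mu is not a finite sum of atoms, there are sets of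
   arbitrarily small positive measure.  Choose the l-th set S_l so small that
   it occupies at most half of each non-null piece of a partition of mesh rho_l,
   and let u be at least c_l on S_l, with c_l^p mu(S_l) = 2^-l, and at most
   c_l / 2 outside a slightly larger set.  Inside each piece, any gradient g of
   u is at least c_l / (4 rho_l^a) a.e. on one of the two parts, so the integral
   of g^p is at least c_l^p mu(S_l) / (4 rho_l^a)^p = 4^-p 2^-l rho_l^(-ap),
   which is unbounded for a suitable choice of the rho_l. *)
Require Import Defs.
From HB Require Import structures.
From mathcomp Require Import all_boot all_order all_algebra.
From mathcomp Require Import all_classical all_reals all_analysis.
From mathcomp Require Import measurable_realfun.
From mathcomp Require Import lra ring.

Set Implicit Arguments.
Unset Strict Implicit.
Unset Printing Implicit Defensive.

Import Order.TTheory GRing.Theory Num.Theory.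
Import numFieldNormedType.Exports.

Local Open Scope classical_set_scope.
Local Open Scope ring_scope.

(** * Elementary facts on real powers *)

Lemma powR_inv (R : realType) (x p : R) : 0 <= x -> x^-1 `^ p = (x `^ p)^-1.
Proof. by move=> x0; rewrite -!powR_inv1 ?powR_ge0// powRAC. Qed.

(** The sum is at most twice the larger summand, which gives a constant valid for every [p >= 0]. *)
Lemma powR_add_le (R : realType) (p a b : R) : 0 <= p -> 0 <= a -> 0 <= b ->
  (a + b) `^ p <= 2 `^ p * (a `^ p + b `^ p).
Proof.
move=> p0 a0 b0; wlog ab : a b a0 b0 / a <= b.
  move=> h; have [ab|/ltW ba] := leP a b; first exact: h.
  by rewrite addrC [X in _ * X]addrC; exact: h.
apply: (@le_trans _ _ ((2 * b) `^ p)).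
  apply: ge0_ler_powR => //; rewrite ?nnegrE ?addr_ge0 ?mulr_ge0//.
  by rewrite mulr2n mulrDl mul1r lerD2r.
by rewrite powRM// ler_wpM2l ?powR_ge0// lerDr powR_ge0.
Qed.

(** * Finite measurable partitions of small mesh *)

Section metric_partition.
Context {R : realType} {d : measure_display} (X : measurableMetricType d R).

Lemma measurable_mball (x : X) (r : R) :
  borel_measurable X -> measurable (ball x r).
Proof.
move=> borelX; suff oB : open (ball x r) by apply: borelX; exact: sub_sigma_algebra.
rewrite openE => y; rewrite ballEmdist /= => xy.
apply/nbhs_ballP; exists (r - mdist x y); rewrite /= ?subr_gt0//.
move=> z; rewrite !ballEmdist /= ltrBrDl; apply: le_lt_trans.
exact: metric_triangle.
Qed.

(** Iterated halving: one ball of radius [D1], larger than all distances, is the whole space, and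
    doubling replaces each ball of a finite cover by finitely many balls of half the radius. *)
Lemma bounded_doubling_cover (r : R) : metric_bounded X -> doubling X ->
  0 < r -> exists s : seq X, setT `<=` \bigcup_(c in [set` s]) ball c r.
Proof.
move=> [D hD] [M hM] r0; pose D1 : R := `|D| + 1.
have D10 : 0 < D1 by rewrite ltr_pwDr.
have step k : exists s : seq X,
    setT `<=` \bigcup_(c in [set` s]) ball c (D1 / 2 ^+ k).
  elim: k => [|k [s hs]].
    have [[x0]|nX] := pselect (exists x : X, True).
      exists [:: x0] => x _; exists x0; first by rewrite /= inE.
      rewrite expr0 divr1 ballEmdist /= (le_lt_trans (hD _ _))//.
      by rewrite (le_lt_trans (ler_norm _))// ltrDl.
    by exists [::] => x _; case: nX; exists x.
  have /choice[f hf] : forall x : X, exists t : seq X,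
      ball x (D1 / 2 ^+ k) `<=` \bigcup_(c in [set` t]) ball c (D1 / 2 ^+ k.+1).
    move=> x; have [|t [_ ht]] := hM x (D1 / 2 ^+ k).
      by rewrite divr_gt0// exprn_gt0.
    by exists t; rewrite exprSr invfM mulrA.
  exists (flatten [seq f x | x <- s]) => x /hs[c cs xc].
  have [c' c't xc'] := hf _ _ xc.
  by exists c' => //=; apply/flatten_mapP; exists c.
have [k hk] : exists k, D1 / 2 ^+ k <= r.
  have : (D1 * 2^-1 ^+ n) @[n --> \oo] --> (D1 * 0 : R).
    by apply: cvgMr; apply: cvg_expr; rewrite ger0_norm// invf_lt1 ?ltr1n.
  rewrite mulr0 => /cvgrPdist_le/(_ _ r0)[k _ /(_ k (leqnn k))] /=.
  rewrite sub0r normrN => h; exists k; apply: le_trans h.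
  by rewrite exprVn ler_norm.
have [s hs] := step k; exists s => x /hs[c cs xc]; exists c => //.
exact: le_ball xc.
Qed.

(** A finite cover by balls of radius [rho / 2] is made disjoint by removing from each ball the
    earlier ones. *)
Lemma small_partition (rho : R) : borel_measurable X -> metric_bounded X ->
  doubling X -> 0 < rho -> exists (N : nat) (A : nat -> set X),
  [/\ forall i, measurable (A i), trivIset setT A,
      \big[setU/set0]_(0 <= i < N) A i = setT &
      forall i x y, A i x -> A i y -> mdist x y <= rho].
Proof.
move=> bX bdX dX rho0.
have [|s hs] := @bounded_doubling_cover (rho / 2) bdX dX; first exact: divr_gt0.
(* [B i] is the ball about the [i]-th centre, and empty past the end of [s]. Going through [ohead]
   avoids a default centre, since [X] may be empty. *)
pose B i := if (i < size s)%N then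
  \bigcup_(c in [set c | ohead (drop i s) = Some c]) ball c (rho / 2) else set0.
have BE i x : (i < size s)%N -> B i = ball (nth x s i) (rho / 2).
  move=> si; rewrite /B si (drop_nth x)//=; apply/seteqP; split.
    by move=> y [c /= [<-]].
  by move=> y hy; exists (nth x s i).
have mB i : measurable (B i).
  have [si|si] := ltnP i (size s).
    by rewrite (BE i (tnth (in_tuple s) (Ordinal si)))//; exact: measurable_mball.
  by rewrite /B ltnNge si /=; exact: measurable0.
exists (size s), (seqDU B); split => //.
- by move=> i; apply: measurableD => //; exact: bigsetU_measurable.
- rewrite big_mkord -bigsetU_seqDU -subTset => x _.
  have [c cs xc] := hs x I; rewrite -bigcup_mkord.
  exists (index c s); rewrite /= ?index_mem//.
  by rewrite (BE _ c) ?index_mem// nth_index.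
- move=> i x y [Bx _] [By _].
  have [si|si] := ltnP i (size s); last by move: Bx; rewrite /B ltnNge si.
  move: Bx By; rewrite (BE i x)// => /ball_sym; rewrite !ballEmdist /= => hx hy.
  rewrite (le_trans (metric_triangle _ (nth x s i) _))//.
  by rewrite (splitr rho) lerD// ltW.
Qed.

End metric_partition.

(** * Sets of arbitrarily small positive measure *)

Section small_sets.
Context {R : realType} {d : measure_display} (X : measurableMetricType d R).
Variable mu : {measure set X -> \bar R}.
Hypothesis mu_fin : (mu setT < +oo)%E.

(** [finite_sum_of_atoms] localised to a subset, so that it can be proved by induction on the size
    of the measure. *)
Let atomic (B : set X) := exists (n : nat) (A : 'I_n -> set X),
  (forall i, atom mu (A i)) /\ mu.-negligible (B `\` \bigcup_i A i).

Let atomicU B C D : atomic B -> atomic C -> D `<=` B `|` C -> atomic D.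
Proof.
move=> [n [A [aA nA]]] [m [A' [aA' nA']]] DBC.
exists (n + m)%N, (fun i : 'I_(n + m) =>
  match fintype.split i with inl j => A j | inr j => A' j end).
split; first by move=> i; case: (fintype.split i).
apply: negligibleS (negligibleU nA nA') => x [/DBC BC nx].
case: BC => [Bx|Cx]; [left|right]; split => // -[j _ jx]; apply: nx.
  by exists (unsplit (inl j)); rewrite ?unsplitK.
by exists (unsplit (inr j)); rewrite ?unsplitK.
Qed.

(** Otherwise every non-null set has measure at least [delta]. A non-null set that is not an atom
    then splits into two non-null parts, each of measure smaller by at least [delta]; by induction
    on [n], every set of measure below [n * delta] is a finite union of atoms up to a null set, and
    so is the whole space. *)
Lemma exists_small_set (delta : R) : ~ finite_sum_of_atoms mu -> 0 < delta ->
  exists A, [/\ measurable A, (0 < mu A)%E & (mu A < delta%:E)%E].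
Proof.
move=> natom d0; apply: contrapT => nsmall.
have big A : measurable A -> mu A != 0%E -> (delta%:E <= mu A)%E.
  move=> mA A0; rewrite leNgt; apply/negP => Ad; apply: nsmall.
  by exists A; split => //; rewrite lt0e A0 measure_ge0.
have fin A : measurable A -> mu A \is a fin_num.
  move=> mA; rewrite ge0_fin_numE// (le_lt_trans _ mu_fin)//.
  by apply: le_measure; rewrite ?inE.
have claim n A : measurable A -> (mu A < (n%:R * delta)%:E)%E -> atomic A.
  elim: n A => [|n IH] A mA hA.
    by move: hA; rewrite mul0r ltNge measure_ge0.
  have [A0|A0] := eqVneq (mu A) 0%E.
    exists 0%N, (fun _ => set0); split; first by case.
    by apply: (@negligibleS _ _ _ _ A) => [x []//|]; exact/negligibleP.
  have [aA|naA] := pselect (atom mu A).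
    exists 1%N, (fun _ => A); split => //.
    rewrite (_ : _ `\` _ = set0); first exact: negligible_set0.
    by apply/seteqP; split => // x [Ax []]; exists ord0.
  have [B [mB BA ltBA B0]] : exists B,
      [/\ measurable B, B `<=` A, (mu B < mu A)%E & mu B != 0%E].
    apply: contrapT => nB; apply: naA; split => //.
      by rewrite lt0e A0 measure_ge0.
    move=> B mB BA ltBA; apply/eqP; apply: contra_notT nB => B0.
    by exists B.
  have mAB : measurable (A `\` B) by exact: measurableD.
  have AE : mu A = (mu B + mu (A `\` B))%E.
    by rewrite -[in LHS](setDUK BA) measureU// setDIK.
  have AB0 : mu (A `\` B) != 0%E.
    by apply: contraTneq ltBA => AB0; rewrite AE AB0 adde0 ltxx.
  have := big _ mB B0; have := big _ mAB AB0; move: hA; rewrite AE.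
  rewrite -(fineK (fin _ mB)) -(fineK (fin _ mAB)) -EFinD !lee_fin !lte_fin.
  move=> hA hAB hB.
  apply: (@atomicU B (A `\` B)); last by move=> x Ax; case: (pselect (B x)); [left|right].
  - apply: IH => //; rewrite -(fineK (fin _ mB)) lte_fin.
    by move: hA; rewrite -natr1 mulrDl mul1r => hA; lra.
  - apply: IH => //; rewrite -(fineK (fin _ mAB)) lte_fin.
    by move: hA; rewrite -natr1 mulrDl mul1r => hA; lra.
apply: natom.
have [n hn] : exists n, (mu setT < (n%:R * delta)%:E)%E.
  exists (Num.truncn (fine (mu setT) / delta)).+1.
  rewrite -(fineK (fin _ measurableT)) lte_fin -ltr_pdivrMr//.
  exact: truncnS_gt.
have [m [A [aA]]] := claim n _ measurableT hn.
by rewrite setTD => ?; exists m, A.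
Qed.

End small_sets.

(** * Estimates on a single piece *)

Section pieces.
Context {R : realType} {d : measure_display} (T : measurableType d).
Variable mu : {measure set T -> \bar R}.
Implicit Types (A N : set T) (u v g h : T -> R) (p rho delta : R).

Lemma measurable_powR_EFin (D : set T) (u : T -> R) (p : R) :
  measurable_fun D u -> measurable_fun D (fun x => (u x `^ p)%:E).
Proof.
move=> mu_; apply/measurable_EFinP.
exact: (@measurableT_comp _ _ _ _ _ _ (@powR R ^~ p)).
Qed.

(** If [h] exceeded its mean plus one, called [c], almost everywhere on [A], integration would give
    [I + mu A <= I], which is absurd for [0 < mu A]. *)
Lemma exists_le_average A N h : measurable A -> mu.-negligible N ->
  (0 < mu A)%E -> (mu A < +oo)%E ->
  measurable_fun A h -> (forall x, 0 <= h x) ->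
  (\int[mu]_(x in A) (h x)%:E < +oo)%E ->
  exists y, [/\ A y, ~ N y &
    ((h y)%:E * mu A <= \int[mu]_(x in A) (h x)%:E + mu A)%E].
Proof.
move=> mA nN A0 Aoo mh h0 hoo; apply: contrapT => nex.
have Afin : mu A \is a fin_num by rewrite ge0_fin_numE// ltW.
have I0 : (0 <= \int[mu]_(x in A) (h x)%:E)%E.
  by apply: integral_ge0 => x _; rewrite lee_fin.
have Ifin : (\int[mu]_(x in A) (h x)%:E)%E \is a fin_num by rewrite ge0_fin_numE.
set I := (\int[mu]_(x in A) (h x)%:E)%E in hoo I0 Ifin nex.
have a0 : 0 < fine (mu A) by rewrite fine_gt0// A0.
pose c := (fine I + fine (mu A)) / fine (mu A).
have c0 : 0 <= c by rewrite divr_ge0 ?addr_ge0 ?fine_ge0// ltW.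
have : (\int[mu]_(x in A) c%:E <= I)%E.
  apply: ae_ge0_le_integral => //.
  - by move=> x _; rewrite lee_fin.
  - exact/measurable_EFinP.
  - apply: negligibleS nN => x /= hx; apply: contrapT => Nx; apply: hx => Ax.
    rewrite lee_fin leNgt; apply/negP => hc; apply: nex; exists x; split => //.
    rewrite -(fineK Afin) -(fineK Ifin) -EFinM -EFinD lee_fin -ler_pdivlMr//.
    exact: ltW.
rewrite integral_cst// -(fineK Afin) -(fineK Ifin) -EFinM lee_fin.
by rewrite /c divfK ?gt_eqF// leNgt ltrDl a0.
Qed.

(** The constant is [u y], where [y] is a point at which |u|^p + g^p is at most its mean plus one.
    On a null piece the second clause does not restrict [c], hence the first clause. *)
Lemma piecewise_constant_approx A N u g p rho : 0 < p -> 0 <= rho ->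
  measurable A -> (mu A < +oo)%E -> mu.-negligible N ->
  measurable_fun A u -> measurable_fun A g -> (forall x, 0 <= g x) ->
  (forall x y, A x -> A y -> ~ N x -> ~ N y ->
    `|u x - u y| <= rho * (g x + g y)) ->
  let I := (\int[mu]_(x in A) (`|u x| `^ p + g x `^ p)%:E)%E in
  (I < +oo)%E ->
  exists c : R, [/\ mu A = 0%E -> c = 0,
    ((`|c| `^ p)%:E * mu A <= I + mu A)%E &
    (\int[mu]_(x in A) (`|u x - c| `^ p)%:E <=
       ((2 * rho) `^ p)%:E * (I + (I + mu A)))%E].
Proof.
move=> p0 rho0 mA Aoo nN mu_ mg g0 hug I Ioo.
have muc c : measurable_fun A (fun x => (`|u x - c| `^ p)%:E).
  apply: measurable_powR_EFin; apply: measurableT_comp => //.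
  exact: measurable_funB.
have mh : measurable_fun A (fun x => `|u x| `^ p + g x `^ p).
  apply: measurable_funD; apply/measurable_EFinP; apply: measurable_powR_EFin => //.
  exact: measurableT_comp.
have I0 : (0 <= I)%E.
  by apply: integral_ge0 => x _; rewrite lee_fin addr_ge0 ?powR_ge0.
have [A0|A0] := eqVneq (mu A) 0%E.
  exists 0; split => //; first by rewrite A0 mule0 adde0.
  rewrite (null_set_integral mA (muc 0) A0).
  apply: mule_ge0; first by rewrite lee_fin powR_ge0.
  by apply: adde_ge0 => //; apply: adde_ge0.
have {}A0 : (0 < mu A)%E by rewrite lt0e A0 measure_ge0.
have [|y [Ay Ny hy]] := exists_le_average mA nN A0 Aoo mh _ Ioo.
  by move=> x; rewrite addr_ge0 ?powR_ge0.
rewrite -/I in hy.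
exists (u y); split; first by move=> A00; rewrite A00 ltxx in A0.
  apply: le_trans hy; rewrite lee_wpmul2r ?measure_ge0// lee_fin.
  by rewrite lerDl powR_ge0.
pose K := (2 * rho) `^ p.
(* The powers of [u] are added to those of [g] so that the integral becomes [K] times the sum of [I]
   and the quantity bounded by [hy]. *)
apply: (@le_trans _ _ (\int[mu]_(x in A)
  (K%:E * ((`|u x| `^ p + g x `^ p)%:E + (`|u y| `^ p + g y `^ p)%:E)))%E).
  apply: (ae_ge0_le_integral mA).
  - by move=> x _; rewrite lee_fin powR_ge0.
  - exact: muc.
  - by move=> x _; rewrite -EFinD -EFinM lee_fin mulr_ge0 ?addr_ge0 ?powR_ge0.
  - apply/measurable_EFinP; apply: measurable_funM => //.
    by apply: measurable_funD.
  - apply: negligibleS nN => x /= hx; apply: contrapT => Nx; apply: hx => Ax.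
    rewrite lee_fin; apply: (@le_trans _ _ ((rho * (g x + g y)) `^ p)).
      apply: ge0_ler_powR; [exact: ltW| | |exact: hug].
        by rewrite nnegrE.
      by rewrite nnegrE mulr_ge0 ?addr_ge0.
    rewrite powRM ?addr_ge0// /K mulrC powRM// mulrAC.
    rewrite ler_wpM2r ?powR_ge0//.
    apply: (le_trans (powR_add_le (ltW p0) (g0 x) (g0 y))).
    by rewrite ler_wpM2l ?powR_ge0// lerD// lerDr powR_ge0.
rewrite ge0_integralZl_EFin ?powR_ge0//; last 2 first.
- by move=> x _; rewrite -EFinD lee_fin !addr_ge0 ?powR_ge0.
- by apply/measurable_EFinP; apply: measurable_funD.
rewrite ge0_integralD//; last 3 first.
- by move=> x _; rewrite lee_fin addr_ge0 ?powR_ge0.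
- exact/measurable_EFinP.
- by move=> x _; rewrite lee_fin addr_ge0 ?powR_ge0.
rewrite integral_cst//.
by rewrite lee_wpmul2l ?lee_fin ?powR_ge0// leeD2l.
Qed.

(** Triangle inequality through the constants [c] and [c']. Its three summands take two applications
    of [powR_add_le], hence the square of 2^p. *)
Lemma integral_powR_sub_le A u v p delta (c c' : R) : 0 < p ->
  measurable A -> measurable_fun A u -> measurable_fun A v ->
  `|c - c'| <= delta ->
  (\int[mu]_(x in A) (`|u x - v x| `^ p)%:E <= (2 `^ p * 2 `^ p)%:E *
    (\int[mu]_(x in A) (`|u x - c| `^ p)%:E +
     (\int[mu]_(x in A) (`|v x - c'| `^ p)%:E + (delta `^ p)%:E * mu A)))%E.
Proof.
move=> p0 mA mu_ mv cd.
have d0 : 0 <= delta by rewrite (le_trans _ cd).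
have muc (w : T -> R) (k : R) : measurable_fun A w ->
    measurable_fun A (fun x => (`|w x - k| `^ p)%:E).
  move=> mw; apply: measurable_powR_EFin; apply: measurableT_comp => //.
  exact: measurable_funB.
have ge0 (w : T -> R) (k : R) x : (0 <= (`|w x - k| `^ p)%:E)%E.
  by rewrite lee_fin powR_ge0.
rewrite -integral_cst// -ge0_integralD//; [|exact: muc|]; last first.
  by move=> x _; rewrite lee_fin powR_ge0.
rewrite -ge0_integralD//; last 3 first.
- exact: muc.
- by move=> x _; rewrite -EFinD lee_fin addr_ge0 ?powR_ge0.
- by apply: emeasurable_funD => //; exact: muc.
rewrite -ge0_integralZl_EFin//; last 2 first.
- by move=> x _; rewrite -!EFinD lee_fin !addr_ge0 ?powR_ge0.
- by apply: emeasurable_funD; [exact: muc|apply: emeasurable_funD => //; exact: muc].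
apply: ge0_le_integral => //.
- apply: measurable_powR_EFin; apply: measurableT_comp => //.
  exact: measurable_funB.
- apply: measurable_funeM; apply: emeasurable_funD; first exact: muc.
  by apply: emeasurable_funD => //; exact: muc.
move=> x _; rewrite -!EFinD -EFinM lee_fin.
have pp a b : 0 <= a -> a <= b -> a `^ p <= b `^ p.
  move=> a0 ab; apply: ge0_ler_powR => //; first exact: ltW.
  by rewrite nnegrE (le_trans a0).
apply: (@le_trans _ _ ((`|u x - c| + (`|v x - c'| + delta)) `^ p)).
  apply: pp => //.
  rewrite (_ : u x - v x = (u x - c) + (- (v x - c') + (c - c'))); last by lra.
  rewrite (le_trans (ler_normD _ _))// lerD2l (le_trans (ler_normD _ _))//.
  by rewrite normrN lerD2l.
apply: (le_trans (powR_add_le (ltW p0) (normr_ge0 _)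
  (addr_ge0 (normr_ge0 _) d0))).
rewrite -mulrA ler_wpM2l ?powR_ge0// mulrDr lerD//.
  by rewrite ler_peMl ?powR_ge0// -[leLHS](powRr0 2);
    apply: ler_powR; rewrite ?ler1n ?ltW.
exact: powR_add_le (ltW p0) (normr_ge0 _) d0.
Qed.

End pieces.

(** * Extraction of Cauchy subsequences *)

Section cauchy_subsequence.
Context {R : realType}.

(** By compactness of the segment, the image of [U] under [c] clusters at some [z]. If the set were
    not in [U], its complement would be, and clustering would yield an index of the complement with
    value within [e] of [z]. *)
Lemma ultra_bounded_near (U : set_system nat) (c : nat -> R) (B e : R) :
  UltraFilter U -> (forall n, `|c n| <= B) -> 0 < e ->
  exists z : R, U [set n | `|z - c n| < e].
Proof.
move=> UU cB e0.
have UB : (c @ U) `[- B, B]%classic.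
  apply: (@filterE _ U) => n /=; rewrite in_itv /= -ler_norml; exact: cB.
have [z [_ zc]] := @segment_compact R (- B) B (c @ U) _ UB.
exists z; have [//|nU] := in_ultra_setVsetC [set n | `|z - c n| < e] UU.
have [_ [[n hn <-]]] := zc (c @` ~` [set n | `|z - c n| < e]) (ball z e)
  (filterS (@preimage_image _ _ c _) nU) (nbhsx_ballx z e e0).
by move=> /hn.
Qed.

(* The ultrafilter replaces the diagonal argument: all the bounded sequences
   occurring in the hypothesis converge along it simultaneously. *)
Lemma cauchy_subsequence (Phi : nat -> nat -> \bar R) (eps : nat -> R) :
  (forall k, exists (N : nat) (c : nat -> nat -> R) (B : nat -> R) (delta : R),
    [/\ 0 < delta, forall i n, `|c i n| <= B i &
        forall m n, (forall i, (i < N)%N -> `|c i m - c i n| <= delta) ->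
          (Phi m n <= (eps k)%:E)%E]) ->
  exists phi : nat -> nat, {homo phi : m n / (m < n)%N} /\
    forall k m n, (k <= m)%N -> (k <= n)%N ->
      (Phi (phi m) (phi n) <= (eps k)%:E)%E.
Proof.
move=> H; have [U [UU infU]] := ultraFilterLemma eventually_filter.
(* [V k] is a [U]-large set of indices on which all finitely many sequences are within [delta / 2]
   of their cluster points, so any two of its members are [eps k]-close. *)
have /choice[V HV] : forall k, exists V : set nat, U V /\
    forall m n, V m -> V n -> (Phi m n <= (eps k)%:E)%E.
  move=> k; have [N [c [B [delta [d0 cB Hc]]]]] := H k.
  have /choice[z hz] : forall i, exists z : R, U [set n | `|z - c i n| < delta / 2].
    by move=> i; apply: ultra_bounded_near (cB i) _; rewrite divr_gt0.
  exists [set n | forall i : 'I_N, `|z i - c i n| < delta / 2]; split.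
    by apply: (@filter_forall _ _
      (fun i : 'I_N => [set n | `|z i - c i n| < delta / 2])) => i; exact: hz.
  move=> m n /= hm hn; apply: Hc => i iN.
  have {}hm := hm (Ordinal iN); have {}hn := hn (Ordinal iN).
  rewrite (_ : c i m - c i n = (z i - c i n) - (z i - c i m)); last by lra.
  by rewrite (le_trans (ler_normB _ _))// (splitr delta) lerD// ltW.
(* [g (k, m)] is an index beyond [m] in all of [V 0], ..., [V k]: this finite intersection meets
   every tail, as [U] refines [eventually]. Iterating [g] with growing [k] gives [phi]. *)
have /choice[g hg] : forall km : nat * nat, exists n, (km.2 < n)%N /\
    forall l, (l <= km.1)%N -> V l n.
  move=> [k m] /=.
  have UA : U [set n | (m < n)%N].
    by apply: infU; exists m.+1.
  have UB : U [set n | forall i : 'I_k.+1, V i n].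
    by apply: (@filter_forall _ _ (fun i : 'I_k.+1 => V i)) => i; exact: (HV i).1.
  have [n [hm hn]] := filter_ex (filterI UA UB).
  exists n; split => // l lk.
  exact: (hn (Ordinal (lk : (l < k.+1)%N))).
pose phi := fix phi k := if k is k'.+1 then g (k, phi k') else g (0%N, 0%N).
have phiV k l : (l <= k)%N -> V l (phi k).
  by case: k => [|k] lk /=; exact: (hg (_, _)).2.
exists phi; split.
  by apply: homo_ltn => [|k]; [exact: ltn_trans|exact: (hg (_, _)).1].
by move=> k m n km kn; apply: (HV k).2; exact: phiV.
Qed.

End cauchy_subsequence.

(** * Limits of rapidly Cauchy sequences in L^p *)

Section completeness.
Context {R : realType} {d : measure_display} (T : measurableType d).
Variable mu : {measure set T -> \bar R}.

Lemma nneseries_geometric_lty (r : R) : 0 <= r < 1 ->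
  (\sum_(0 <= k <oo) (r ^+ k)%:E < +oo)%E.
Proof.
move=> /andP[r0 r1].
have rn : `|r| < 1 by rewrite ger0_norm.
have h := @cvg_geometric_series R 1 r rn.
rewrite (_ : (fun n => _) = EFin \o series (geometric 1 r)); last first.
  apply/funext => n /=; rewrite sumEFin; congr EFin.
  by apply: eq_bigr => i _; rewrite /= mul1r.
rewrite (cvg_lim _ (cvg_EFin _ h)) ?ltry//.
exact: nearW.
Qed.

(** The series of increments is dominated by a geometric series of ratio 1/2. *)
Lemma rapid_increments_cvg (w : nat -> R) (C : R) :
  (forall k, 2 ^+ k * `|w k.+1 - w k| <= C) -> cvgn w.
Proof.
move=> hC.
have C0 : 0 <= C by rewrite (le_trans _ (hC 0%N))// mulr_ge0.
have : cvgn (series (telescope w)).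
  apply: normed_cvg; apply: (@series_le_cvg _ _ (geometric C 2^-1)) => [n|n|n|].
  - exact: normr_ge0.
  - by rewrite geometric_ge0.
  - rewrite /= exprVn ler_pdivlMr ?exprn_gt0// mulrC; exact: hC.
  - by apply: is_cvg_geometric_series; rewrite ger0_norm// invf_lt1 ?ltr1n.
rewrite telescopeK => h.
rewrite (_ : w = (fun n => w n - w 0%N) + cst (w 0%N)).
  by apply: is_cvgD => //; exact: is_cvg_cst.
by apply/funext => n /=; rewrite fctE subrK.
Qed.

(** Weighted by 2^(kp), the functions |w k - w k.+1|^p have integrals at most 2^-k, so their sum [H]
    is finite a.e. There 2^k |w k - w k.+1| is at most H^(1/p), which forces pointwise convergence,
    and Fatou's lemma carries the integral bounds to the limit. *)
Lemma rapid_cauchy_Lp_limit (p : R) (w : nat -> T -> R) : 0 < p ->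
  (forall n, measurable_fun setT (w n)) ->
  let e k := ((2 ^+ k) `^ p)^-1 * 2^-1 ^+ k in
  (forall k n, (k <= n)%N ->
    (\int[mu]_x (`|w k x - w n x| `^ p)%:E <= (e k)%:E)%E) ->
  exists v : T -> R, measurable_fun setT v /\
    forall k, (\int[mu]_x (`|w k x - v x| `^ p)%:E <= (e k)%:E)%E.
Proof.
move=> p0 mw e hw.
have mB (u v : T -> R) : measurable_fun setT u -> measurable_fun setT v ->
    measurable_fun setT (fun x : T => (`|u x - v x| `^ p)%:E).
  move=> mu_ mv; apply: measurable_powR_EFin; apply: measurableT_comp => //.
  exact: measurable_funB.
have pB (u v : T -> R) x : (0 <= (`|u x - v x| `^ p)%:E)%E.
  by rewrite lee_fin powR_ge0.
pose a k x := (((2 ^+ k) `^ p)%:E * (`|w k x - w k.+1 x| `^ p)%:E)%E.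
have a0 k x : (0 <= a k x)%E by rewrite mule_ge0 ?lee_fin ?powR_ge0.
have ma k : measurable_fun setT (a k).
  by apply: measurable_funeM; exact: mB.
pose H x := (\sum_(0 <= k <oo) a k x)%E.
have mH : measurable_fun setT H by apply: ge0_emeasurable_sum => //.
have H0 x : (0 <= H x)%E by apply: nneseries_ge0.
have Hoo : (\int[mu]_x H x < +oo)%E.
  rewrite integral_nneseries//.
  apply: le_lt_trans (@nneseries_geometric_lty 2^-1 _); last first.
    by rewrite invr_ge0 ler0n invf_lt1 ?ltr1n.
  apply: lee_nneseries => [k _ _|k _]; first exact: integral_ge0.
  rewrite ge0_integralZl_EFin ?powR_ge0//; last exact: mB.
  apply: (@le_trans _ _ (((2 ^+ k) `^ p)%:E * (e k)%:E)%E).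
    by rewrite lee_wpmul2l ?lee_fin ?powR_ge0// hw.
  by rewrite -EFinM lee_fin mulrA divff ?mul1r// gt_eqF// powR_gt0// exprn_gt0.
have Hae : {ae mu, forall x, setT x -> H x \is a fin_num}.
  apply: integrable_ae => //; apply/integrableP; split => //.
  by under eq_integral do rewrite gee0_abs//.
have cvgw x : H x \is a fin_num -> cvgn (w ^~ x).
  move=> Hx; apply: (@rapid_increments_cvg _ (fine (H x) `^ p^-1)) => k.
  have : (a k x <= H x)%E.
    apply: le_trans (nneseries_lim_ge k.+1 (fun n _ _ => a0 n x)).
    by rewrite big_nat_recr//= leeDr// sume_ge0.
  rewrite /a -(fineK Hx) -EFinM lee_fin -powRM ?exprn_ge0// => h.
  have -> : 2 ^+ k * `|w k.+1 x - w k x| =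
      ((2 ^+ k * `|w k x - w k.+1 x|) `^ p) `^ p^-1.
    by rewrite -powRrM divff ?gt_eqF// powRr1 ?mulr_ge0 ?exprn_ge0// distrC.
  apply: ge0_ler_powR; rewrite ?invr_ge0 ?(ltW p0) ?nnegrE ?powR_ge0//.
  exact: (fine_ge0 (H0 x)).
(* The upper limit is measurable on the whole space and equals the limit wherever [H] is finite. *)
pose v x := fine (limn_esup (fun n => (w n x)%:E)).
have mv : measurable_fun setT v.
  apply: (@measurableT_comp _ _ _ _ _ _ (@fine R)) => //.
  by apply: measurable_fun_limn_esup => n; exact/measurable_EFinP.
have wv x : H x \is a fin_num -> w n x @[n --> \oo] --> v x.
  move=> /cvgw cw.
  have h : (w n x)%:E @[n --> \oo] --> (limn (w ^~ x))%:E.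
    by apply: cvg_EFin; [exact: nearW|exact: cw].
  by rewrite /v (cvg_limn_einf_sup h).2; exact: cw.
exists v; split => // k.
pose f m x := (`|w k x - w m x| `^ p)%:E.
(* Each tail contains the index [maxn m k], at least [k], where the Cauchy bound applies. *)
have lef : (limn_einf (fun m => \int[mu]_x f m x) <= (e k)%:E)%E.
  rewrite limn_einf_lim; apply: lime_le; first exact: is_cvg_einfs.
  apply: nearW => m; apply: ereal_inf_le.
  exists (\int[mu]_x f (maxn m k) x)%E; last by apply: hw; exact: leq_maxr.
  by exists (maxn m k) => //=; exact: leq_maxl.
apply: le_trans lef; apply: le_trans (@fatou _ _ _ mu setT measurableT f _ _) => //.
- apply: ae_ge0_le_integral => //.
  + exact: mB.
  + move=> x _; rewrite limn_einf_lim; apply: lime_ge; first exact: is_cvg_einfs.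
    by apply: nearW => m; apply: le_ereal_inf_tmp => _ [n _ <-]; exact: pB.
  + apply: measurableT_comp => //; apply: measurable_fun_limn_esup => n.
    by apply: measurableT_comp => //; exact: mB.
  + apply: filterS Hae => x /(_ I) /wv wvx _.
    (* Continuity of the power is obtained from its derivative, hence at positive arguments; at 0
       the left side vanishes and nonnegativity suffices. *)
    have [->|y0] := eqVneq (w k x - v x) 0.
      rewrite normr0 powR0 ?gt_eqF// limn_einf_lim.
      apply: lime_ge; first exact: is_cvg_einfs.
      by apply: nearW => m; apply: le_ereal_inf_tmp => _ [n _ <-]; exact: pB.
    suff h : f n x @[n --> \oo] --> (`|w k x - v x| `^ p)%:E.
      by rewrite (cvg_limn_einf_sup h).1.
    apply: cvg_EFin; first exact: nearW.
    apply: (@continuous_cvg _ R R \oo _ (fun n => `|w k x - w n x|)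
      (fun y : R => y `^ p) `|w k x - v x|).
      apply: differentiable_continuous; apply/derivable1_diffP.
      by apply: derivable_powR; rewrite in_itv /= normr_gt0 y0.
    by apply: cvg_norm; apply: cvgB => //; exact: cvg_cst.
- by move=> n; exact: mB.
- by move=> n x _; exact: pB.
Qed.

End completeness.

(** * A function with concentrated peaks *)

Section lacunary.
Context {R : realType} {d : measure_display} (T : measurableType d).
Variable mu : {measure set T -> \bar R}.
Hypothesis small : forall delta : R, 0 < delta ->
  exists A, [/\ measurable A, (0 < mu A)%E & (mu A < delta%:E)%E].

Lemma lacunary_sets (eta : nat -> R) (K : R) : (forall l, 0 < eta l) -> 0 < K ->
  exists (S : nat -> set T) (s : nat -> R), forall l,
    [/\ measurable (S l), mu (S l) = (s l)%:E, 0 < s l, s l <= eta l &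
        K * s l.+1 <= s l].
Proof.
move=> eta0 K0.
have /choice[f hf] : forall delta : R, exists A : set T, 0 < delta ->
    [/\ measurable A, mu A = (fine (mu A))%:E, 0 < fine (mu A) &
        fine (mu A) < delta].
  (* [set0] is a dummy value making the choice function total. *)
  move=> delta; have [d0|d0] := ltP 0 delta; last by exists set0.
  have [A [mA A0 Ad]] := small d0; exists A => _.
  have Afin : mu A \is a fin_num.
    by rewrite ge0_fin_numE// (lt_trans Ad)// ltry.
  split => //; first by rewrite fineK.
    by rewrite fine_gt0// A0 (lt_trans Ad)// ltry.
  by rewrite -lte_fin fineK.
pose S := fix S l := if l is l'.+1
  then f (Num.min (eta l) (fine (mu (S l')) / K)) else f (eta 0%N).
have hS l : [/\ measurable (S l), mu (S l) = (fine (mu (S l)))%:E,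
    0 < fine (mu (S l)) & fine (mu (S l)) < eta l].
  elim: l => [|l [_ _ IH _]]; first exact: hf.
  have [|? ? ?] := hf (Num.min (eta l.+1) (fine (mu (S l)) / K)).
    by rewrite lt_min eta0 divr_gt0.
  by rewrite lt_min => /andP[? _]; split.
exists S, (fun l => fine (mu (S l))) => l.
have [mS SE S0 Seta] := hS l; split => //; first exact: ltW.
have [|_ _ _] := hf (Num.min (eta l.+1) (fine (mu (S l)) / K)).
  by rewrite lt_min eta0 divr_gt0.
by rewrite lt_min => /andP[_ /ltW h]; rewrite mulrC -ler_pdivlMr.
Qed.

(** With [b] equal to 2^p, this makes the terms of u^p before the [l]-th add up to at most 2^-p
    times the [l]-th coefficient, that is, half of [c l] after taking roots. *)
Lemma geometric_sum_lt (gam : nat -> R) (b : R) : 0 < b ->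
  (forall l, 0 <= gam l) -> (forall l, (b + 1) * gam l <= gam l.+1) ->
  forall l, b * \sum_(0 <= i < l) gam i <= gam l.
Proof.
move=> b0 g0 hg; elim=> [|l IH]; first by rewrite big_nil mulr0.
rewrite big_nat_recr//= mulrDr (le_trans _ (hg l))//.
by rewrite mulrDl mul1r addrC lerD2l.
Qed.

(* [u ^ p] is the sum of the [2 ^- l / mu (S l)] times the indicator of [S l],
   so that each [S l] contributes [2 ^- l] to the integral, however fast the
   measures of the [S l] decrease. *)
Lemma lacunary_function (p : R) (eta : nat -> R) : 0 < p ->
  (forall l, 0 < eta l) ->
  exists (u : T -> R) (N : set T) (S V : nat -> set T) (c : nat -> R),
  [/\ measurable_fun setT u, forall x, 0 <= u x,
      (\int[mu]_x (u x `^ p)%:E < +oo)%E, mu.-negligible N &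
   forall l, [/\ measurable (S l), measurable (V l),
      (mu (S l) <= (eta l)%:E)%E /\ (mu (V l) <= (2 * eta l)%:E)%E,
      0 < c l /\ ((c l `^ p)%:E * mu (S l) = (2^-1 ^+ l)%:E)%E &
      (forall x, S l x -> ~ N x -> c l <= u x) /\
      (forall x, ~ V l x -> ~ N x -> u x <= c l / 2)]].
Proof.
move=> p0 eta0; pose b : R := 2 `^ p.
have b0 : 0 < b by rewrite powR_gt0.
(* The factor 2 offsets the decay of 2^-l in [gam], leaving growth by [b + 1]. As the ratio is at
   least 2, the tails of [s] are also dominated by geometric ones, which bounds [V l]. *)
have [|S [s hS]] := @lacunary_sets eta (2 * (b + 1)) eta0.
  by rewrite mulr_gt0// addr_gt0.
have mS l : measurable (S l) by case: (hS l).
have s0 l : 0 < s l by case: (hS l).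
have sS l : 2 * (b + 1) * s l.+1 <= s l by case: (hS l).
have muS l : mu (S l) = (s l)%:E by case: (hS l).
pose gam l := 2^-1 ^+ l / s l.
have gam0 l : 0 < gam l by rewrite divr_gt0// exprn_gt0// invr_gt0.
have gamS l : (b + 1) * gam l <= gam l.+1.
  rewrite /gam exprS ler_pdivlMr// -mulrA mulrCA mulrC.
  rewrite [leLHS](_ : _ = 2^-1 * 2^-1 ^+ l * (2 * (b + 1) * s l.+1 / s l)).
    by rewrite ler_piMr ?mulr_ge0 ?exprn_ge0// ler_pdivrMr// mul1r.
  by field; rewrite gt_eqF.
have sumgam := geometric_sum_lt b0 (fun l => ltW (gam0 l)) gamS.
pose G x := (\sum_(0 <= l <oo) ((gam l)%:E * (\1_(S l) x : R)%:E))%E.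
have ga0 l x : (0 <= (gam l)%:E * (\1_(S l) x : R)%:E)%E.
  by rewrite mule_ge0 ?lee_fin// ltW.
have mga l : measurable_fun setT (fun x => (gam l)%:E * (\1_(S l) x : R)%:E)%E.
  by apply: measurable_funeM; apply/measurable_EFinP; exact: measurable_indic.
have mG : measurable_fun setT G by apply: ge0_emeasurable_sum.
have G0 x : (0 <= G x)%E by apply: nneseries_ge0.
have Goo : (\int[mu]_x G x < +oo)%E.
  rewrite integral_nneseries//.
  apply: le_lt_trans (@nneseries_geometric_lty R 2^-1 _); last first.
    by rewrite invr_ge0 ler0n invf_lt1 ?ltr1n.
  apply: lee_nneseries => [l _ _|l _]; first exact: integral_ge0.
  rewrite ge0_integralZl_EFin ?(ltW (gam0 l))//; last first.
    by apply/measurable_EFinP; exact: measurable_indic.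
  by rewrite integral_indic// setIT muS -EFinM /gam divfK// gt_eqF.
have Gae : {ae mu, forall x, setT x -> G x \is a fin_num}.
  apply: integrable_ae => //; apply/integrableP; split => //.
  by under eq_integral do rewrite gee0_abs//.
(* Outside [V l] only the terms of [G] before the [l]-th survive. *)
pose V l := \bigcup_j S (l + j)%N.
have mV l : measurable (V l) by apply: bigcup_measurable.
have muV l : (mu (V l) <= (2 * s l)%:E)%E.
  apply: (le_trans (measure_sigma_subadditive _
    (fun j => mS (l + j)%N) (mV l) _)) => //.
  apply: (le_trans _ (@epsilon_trick0 R (2 * s l) xpredT _)); last first.
    by rewrite mulr_ge0// ltW.
  apply: lee_nneseries => [j _ _|j _]; first exact: measure_ge0.
  rewrite muS lee_fin; elim: j => [|j IH].
    by rewrite addn0 expn1 mulrC mulKf.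
  rewrite addnS expnS natrM invfM mulrCA -ler_pdivrMl ?invr_gt0// invrK.
  apply: le_trans IH; apply: le_trans (sS _).
  by rewrite ler_wpM2r ?(ltW (s0 _))// ler_peMr// lerDr ltW.
pose u x := fine (G x) `^ p^-1.
exists u, [set x | ~ G x \is a fin_num], S, V, (fun l => gam l `^ p^-1).
have uG x : u x `^ p = fine (G x).
  by rewrite /u -powRrM mulVf ?gt_eqF// powRr1// fine_ge0.
have le_root a e : 0 <= a -> a <= e -> a `^ p^-1 <= e `^ p^-1.
  move=> a0 ae; apply: ge0_ler_powR => //; first by rewrite invr_ge0 ltW.
  by rewrite nnegrE (le_trans a0).
split.
- apply: (@measurableT_comp _ _ _ _ _ _ (@powR R ^~ p^-1)) => //.
  by apply: (@measurableT_comp _ _ _ _ _ _ (@fine R)).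
- by move=> x; exact: powR_ge0.
- apply: le_lt_trans Goo; apply: ge0_le_integral => //.
  + by move=> x _; rewrite lee_fin powR_ge0.
  + apply: measurable_powR_EFin.
    apply: (@measurableT_comp _ _ _ _ _ _ (@powR R ^~ p^-1)) => //.
    by apply: (@measurableT_comp _ _ _ _ _ _ (@fine R)).
  + move=> x _; rewrite uG; case: (G x) (G0 x) => //= _; exact: leey.
- by apply: negligibleS Gae => x /= Gx h; apply: Gx; exact: h.
- move=> l; split => //.
  + have [_ _ _ se _] := hS l; rewrite muS lee_fin; split => //.
    by rewrite (le_trans (muV l))// lee_fin ler_wpM2l.
  + split; first exact: powR_gt0.
    rewrite -powRrM mulVf ?gt_eqF// powRr1 ?ltW// muS -EFinM.
    by rewrite /gam divfK// gt_eqF.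
  + split=> x Sx /= /contrapT Gx.
      apply: le_root; first exact: ltW.
      rewrite -lee_fin fineK//.
      apply: le_trans (nneseries_lim_ge l.+1 (fun n _ _ => ga0 n x)).
      rewrite big_nat_recr//= indicE mem_set// mule1 leeDr// sume_ge0//.
    (* Halving [c l] amounts to dividing [gam l] by [b], which is 2^p. *)
    have -> : gam l `^ p^-1 / 2 = (gam l / b) `^ p^-1.
      rewrite [RHS](powRM _ (ltW (gam0 l))) ?invr_ge0 ?(ltW b0)//; congr (_ * _).
      by rewrite /b -powRN -powRrM mulNr divff ?gt_eqF// powR_inv1.
    apply: le_root; first exact: fine_ge0.
    rewrite -lee_fin fineK// /G (nneseries_split 0%N l)//.
    rewrite [X in (_ + X)%E]eseries0 ?adde0; last first.
      move=> i li _; rewrite indicE memNset ?mule0// => Six; apply: Sx.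
      by exists (i - l)%N => //; rewrite subnKC.
    apply: (@le_trans _ _ (\sum_(0 <= i < 0 + l) (gam i)%:E)%E).
      by apply: lee_sum => i _; rewrite -EFinM lee_fin ler_piMr ?(ltW (gam0 i)).
    by rewrite sumEFin lee_fin add0n ler_pdivlMr// mulrC.
Qed.

End lacunary.

(** * Lower bounds for gradients of peaked functions *)

Section gradient_lower_bound.
Context {R : realType} {d : measure_display} (T : measurableType d).
Variable mu : {measure set T -> \bar R}.

Lemma integral_powR_ge (A B N : set T) (g : T -> R) (p k : R) :
  0 < p -> 0 <= k -> measurable A -> measurable B -> B `<=` A ->
  measurable_fun setT g -> (forall x, 0 <= g x) -> mu.-negligible N ->
  (forall x, B x -> ~ N x -> k <= g x) ->
  ((k `^ p)%:E * mu B <= \int[mu]_(x in A) (g x `^ p)%:E)%E.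
Proof.
move=> p0 k0 mA mB BA mg g0 nN hk.
have mgp D : measurable D -> measurable_fun D (fun x => (g x `^ p)%:E).
  by move=> mD; apply: measurable_powR_EFin; exact: measurable_funTS.
apply: (@le_trans _ _ (\int[mu]_(x in B) (g x `^ p)%:E)%E); last first.
  apply: ge0_subset_integral => //; first exact: mgp.
  by move=> x _; rewrite lee_fin powR_ge0.
rewrite -integral_cst//; apply: (ae_ge0_le_integral mB) => //.
- by move=> x _; rewrite lee_fin powR_ge0.
- by move=> x _; rewrite lee_fin powR_ge0.
- exact: mgp.
- apply: negligibleS nN => x /= hx; apply: contrapT => Nx; apply: hx => Bx.
  by rewrite lee_fin ge0_ler_powR ?nnegrE ?(ltW p0)//; exact: hk.
Qed.

(** Let [k] be [c / (4 * rho)]. Either [g] is at least [k] on [A] within [S], off [N], or some [x]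
    there has [g x < k]. In the second case [u] drops by at least [c / 2] from [x] to any [y] of [A]
    outside [V] and [N], so [g y >= c / (2 * rho) - k = k], on a set at least as large. *)
Lemma gradient_lower_bound_piece (A S V N : set T) (u g : T -> R) (p c rho : R) :
  0 < p -> 0 < c -> 0 < rho ->
  measurable A -> measurable S -> measurable V -> mu.-negligible N ->
  measurable_fun setT g -> (forall x, 0 <= g x) ->
  (mu (A `&` S) <= mu (A `\` V))%E ->
  (forall x, S x -> ~ N x -> c <= u x) ->
  (forall x, ~ V x -> ~ N x -> u x <= c / 2) ->
  (forall x y, A x -> A y -> ~ N x -> ~ N y ->
    `|u x - u y| <= rho * (g x + g y)) ->
  (((c / (4 * rho)) `^ p)%:E * mu (A `&` S) <=
    \int[mu]_(x in A) (g x `^ p)%:E)%E.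
Proof.
move=> p0 c0 rho0 mA mS mV nN mg g0 SV uS uV hug.
have k0 : 0 <= c / (4 * rho) by rewrite divr_ge0 ?mulr_ge0// ltW.
have [hS|] := pselect (forall x, (A `&` S) x -> ~ N x -> c / (4 * rho) <= g x).
  apply: (integral_powR_ge (N := N)) => //; first exact: measurableI.
move=> /existsNP[x /not_implyP[[Ax Sx]] /not_implyP[Nx /negP]].
rewrite -ltNge => gx.
apply: (@le_trans _ _ (((c / (4 * rho)) `^ p)%:E * mu (A `\` V))%E).
  by rewrite lee_wpmul2l// lee_fin powR_ge0.
apply: (integral_powR_ge (N := N)) => //; first exact: measurableD.
move=> y [Ay Vy] Ny.
have h := le_trans (ler_norm _) (hug _ _ Ax Ay Nx Ny).
have hx := uS _ Sx Nx; have hy := uV _ Vy Ny.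
have -> : c / (4 * rho) = c / 2 / rho - c / (4 * rho).
  by field; rewrite gt_eqF.
rewrite lerBlDr; apply: (@le_trans _ _ (g y + g x)); last first.
  by rewrite lerD2l ltW.
rewrite ler_pdivrMr// (addrC (g y)) [leRHS]mulrC.
by apply: le_trans h; lra.
Qed.

Lemma gradient_lower_bound n (A : nat -> set T) (S V N : set T) (u g : T -> R)
    (p c rho : R) :
  0 < p -> 0 < c -> 0 < rho ->
  (forall i, measurable (A i)) -> trivIset setT A ->
  \big[setU/set0]_(0 <= i < n) A i = setT ->
  measurable S -> measurable V -> mu.-negligible N ->
  measurable_fun setT g -> (forall x, 0 <= g x) ->
  (forall i, (i < n)%N -> (mu (A i `&` S) <= mu (A i `\` V))%E) ->
  (forall x, S x -> ~ N x -> c <= u x) ->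
  (forall x, ~ V x -> ~ N x -> u x <= c / 2) ->
  (forall i x y, A i x -> A i y -> ~ N x -> ~ N y ->
    `|u x - u y| <= rho * (g x + g y)) ->
  (((c / (4 * rho)) `^ p)%:E * mu S <= \int[mu]_x (g x `^ p)%:E)%E.
Proof.
move=> p0 c0 rho0 mA tA AT mS mV nN mg g0 SV uS uV hug.
have mAS i : measurable (A i `&` S) by exact: measurableI.
rewrite -AT ge0_integral_bigsetU//; last 4 first.
- exact: iota_uniq.
- by apply: sub_trivIset tA.
- by rewrite AT; exact: measurable_powR_EFin.
- by move=> x _; rewrite lee_fin powR_ge0.
apply: (@le_trans _ _ (((c / (4 * rho)) `^ p)%:E *
    \sum_(0 <= i < n) mu (A i `&` S))%E).
  rewrite lee_wpmul2l ?lee_fin ?powR_ge0// big_mkord.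
  apply: (@content_subadditive _ _ _ mu S (fun i => A i `&` S) n) => //.
  by rewrite -big_distrl/= -(big_mkord xpredT A) AT setTI.
rewrite ge0_sume_distrr//; rewrite !big_mkord; apply: lee_sum => i _.
apply: (@gradient_lower_bound_piece _ S V N u) => //; last exact: hug.
exact: SV.
Qed.

End gradient_lower_bound.

(** * Summation over the pieces of a partition *)

Section partition_estimates.
Context {R : realType} {d : measure_display} (T : measurableType d).
Variable mu : {measure set T -> \bar R}.
Hypothesis mu_fin : (mu setT < +oo)%E.
Variables (n : nat) (A : nat -> set T).
Hypothesis mA : forall i, measurable (A i).
Hypothesis tA : trivIset setT A.
Hypothesis AT : \big[setU/set0]_(0 <= i < n) A i = setT.

Let M := fine (mu setT).

Let muT : mu setT = M%:E.
Proof. by rewrite /M fineK// ge0_fin_numE. Qed.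

Let sum_add3 (f g h : nat -> \bar R) :
  (\sum_(0 <= i < n) (f i + (g i + h i)) = \sum_(0 <= i < n) f i +
    (\sum_(0 <= i < n) g i + \sum_(0 <= i < n) h i))%E.
Proof. by rewrite !big_split. Qed.

Lemma ge0_integral_partition (f : T -> \bar R) : measurable_fun setT f ->
  (forall x, 0 <= f x)%E ->
  (\int[mu]_x f x = \sum_(0 <= i < n) \int[mu]_(x in A i) f x)%E.
Proof.
move=> mf f0; rewrite -AT ge0_integral_bigsetU//.
- exact: iota_uniq.
- exact: sub_trivIset tA.
- by rewrite AT.
Qed.

Lemma measure_partition : (\sum_(0 <= i < n) mu (A i) = M%:E)%E.
Proof. by rewrite big_mkord -measure_bigsetU// -(big_mkord xpredT A) AT. Qed.

(** The bound on [c i] depends on [u] and [g] only through [K], so along a bounded sequence of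
    functions the constants of each piece form a bounded real sequence. *)
Lemma piecewise_constant_approx_partition (N : set T) (u g : T -> R)
    (p rho K : R) : 0 < p -> 0 <= rho -> mu.-negligible N ->
  measurable_fun setT u -> measurable_fun setT g -> (forall x, 0 <= g x) ->
  (forall i x y, A i x -> A i y -> ~ N x -> ~ N y ->
    `|u x - u y| <= rho * (g x + g y)) ->
  (\int[mu]_x (`|u x| `^ p + g x `^ p)%:E <= K%:E)%E ->
  exists c : nat -> R,
    (forall i, `|c i| <= ((K + M) / fine (mu (A i))) `^ p^-1) /\
    (\sum_(0 <= i < n) \int[mu]_(x in A i) (`|u x - c i| `^ p)%:E <=
      ((2 * rho) `^ p * (K + (K + M)))%:E)%E.
Proof.
move=> p0 rho0 nN mu_ mg g0 hug hK.
have mh : measurable_fun setT (fun x => (`|u x| `^ p + g x `^ p)%:E).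
  apply/measurable_EFinP; apply: measurable_funD; apply/measurable_EFinP;
    apply: measurable_powR_EFin => //.
  exact: measurableT_comp.
have h0 x : (0 <= (`|u x| `^ p + g x `^ p)%:E)%E.
  by rewrite lee_fin addr_ge0 ?powR_ge0.
pose I i := (\int[mu]_(x in A i) (`|u x| `^ p + g x `^ p)%:E)%E.
have IK i : (I i <= K%:E)%E.
  by apply: le_trans hK; apply: ge0_subset_integral.
have muAM i : (mu (A i) <= M%:E)%E by rewrite -muT le_measure ?inE.
have muAoo i : (mu (A i) < +oo)%E by rewrite (le_lt_trans (muAM i)) ?ltry.
have /choice[c hc] : forall i, exists c : R, [/\ mu (A i) = 0%E -> c = 0,
    ((`|c| `^ p)%:E * mu (A i) <= I i + mu (A i))%E &
    (\int[mu]_(x in A i) (`|u x - c| `^ p)%:E <=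
       ((2 * rho) `^ p)%:E * (I i + (I i + mu (A i))))%E].
  move=> i; apply: (piecewise_constant_approx (N := N)) => //.
  - exact: measurable_funTS.
  - exact: measurable_funTS.
  - exact: hug.
  - by rewrite (le_lt_trans (IK i)) ?ltry.
exists c; split.
  move=> i; have [c0 hci _] := hc i.
  (* On a null piece the bound contains a division by 0; it holds because [c i] is 0. *)
  have [Ai0|Ai0] := eqVneq (mu (A i)) 0%E.
    by rewrite c0// normr0 powR_ge0.
  have Afin : mu (A i) \is a fin_num by rewrite ge0_fin_numE.
  have A0 : 0 < fine (mu (A i)) by rewrite fine_gt0// muAoo lt0e Ai0 measure_ge0.
  have : `|c i| `^ p <= (K + M) / fine (mu (A i)).
    rewrite ler_pdivlMr// -lee_fin EFinM fineK// (le_trans hci)//.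
    by rewrite EFinD leeD.
  move=> h; have -> : `|c i| = (`|c i| `^ p) `^ p^-1.
    by rewrite -powRrM divff ?gt_eqF// powRr1.
  by apply: ge0_ler_powR; rewrite ?invr_ge0 ?(ltW p0) ?nnegrE ?powR_ge0//
    (le_trans _ h) ?powR_ge0.
apply: (@le_trans _ _ (\sum_(0 <= i < n)
  ((2 * rho) `^ p)%:E * (I i + (I i + mu (A i))))%E).
  by rewrite !big_mkord; apply: lee_sum => i _; have [] := hc i.
have I0 i : (0 <= I i)%E by exact: integral_ge0.
rewrite -ge0_sume_distrr; last first.
  by move=> i _; apply: adde_ge0 => //; apply: adde_ge0.
rewrite EFinM lee_wpmul2l ?lee_fin ?powR_ge0// sum_add3.
rewrite measure_partition -(ge0_integral_partition mh h0) !EFinD.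
by rewrite leeD// leeD.
Qed.

(** This reduces closeness in L^p to closeness of finitely many real constants. *)
Lemma partition_dist_le (u v : T -> R) (c c' : nat -> R) (p delta E : R) :
  0 < p -> measurable_fun setT u -> measurable_fun setT v ->
  (\sum_(0 <= i < n) \int[mu]_(x in A i) (`|u x - c i| `^ p)%:E <= E%:E)%E ->
  (\sum_(0 <= i < n) \int[mu]_(x in A i) (`|v x - c' i| `^ p)%:E <= E%:E)%E ->
  (forall i, (i < n)%N -> `|c i - c' i| <= delta) ->
  (\int[mu]_x (`|u x - v x| `^ p)%:E <=
    (2 `^ p * 2 `^ p * (E + (E + delta `^ p * M)))%:E)%E.
Proof.
move=> p0 mu_ mv uE vE cc.
rewrite ge0_integral_partition; last 2 first.
- apply: measurable_powR_EFin; apply: measurableT_comp => //.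
  exact: measurable_funB.
- by move=> x; rewrite lee_fin powR_ge0.
apply: (@le_trans _ _ (\sum_(0 <= i < n) (2 `^ p * 2 `^ p)%:E *
    (\int[mu]_(x in A i) (`|u x - c i| `^ p)%:E +
     (\int[mu]_(x in A i) (`|v x - c' i| `^ p)%:E + (delta `^ p)%:E * mu (A i))))%E).
  rewrite !big_mkord; apply: lee_sum => i _; apply: integral_powR_sub_le => //.
  - exact: measurable_funTS.
  - exact: measurable_funTS.
  - exact: cc.
have J0 (w : T -> R) k i : (0 <= \int[mu]_(x in A i) (`|w x - k| `^ p)%:E)%E.
  by apply: integral_ge0 => x _; rewrite lee_fin powR_ge0.
have d0 i : (0 <= (delta `^ p)%:E * mu (A i))%E.
  by rewrite mule_ge0 ?lee_fin ?powR_ge0.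
rewrite -ge0_sume_distrr; last first.
  by move=> i _; apply: adde_ge0 => //; apply: adde_ge0.
rewrite [leRHS]EFinM lee_wpmul2l ?lee_fin ?mulr_ge0 ?powR_ge0// sum_add3.
rewrite -ge0_sume_distrr// measure_partition !EFinD EFinM.
by rewrite leeD// leeD.
Qed.

End partition_estimates.

(** * Norms and gradients in terms of integrals of [p]-th powers *)

Section hajlasz.
Context {R : realType} {d : measure_display} (X : measurableMetricType d R).
Variable mu : {measure set X -> \bar R}.

Lemma Lp_normE (p : R) (u : X -> R) :
  Lp_norm mu p u = ((\int[mu]_x (`|u x| `^ p)%:E) `^ p^-1)%E.
Proof. by rewrite /Lp_norm unlock. Qed.

Lemma Lp_spaceP (p : R) (u : X -> R) : 0 < p -> Lp_space mu p u <->
  measurable_fun setT u /\ (\int[mu]_x (`|u x| `^ p)%:E < +oo)%E.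
Proof.
move=> p0; split=> [/andP[]|[mu_ uoo]].
  rewrite !inE /= /finite_norm => mu_ uoo; split => //.
  apply: (@lty_poweRy _ _ p^-1); first by rewrite invr_eq0 gt_eqF.
  by rewrite -Lp_normE.
by apply/andP; rewrite !inE /= /finite_norm; split => //;
  rewrite -/(Lp_norm mu p u) Lp_normE poweR_lty.
Qed.

Lemma poweR_root_le (I : \bar R) (p D : R) : 0 < p -> (0 <= I)%E ->
  (I `^ p^-1 <= D%:E)%E -> (I <= (D `^ p)%:E)%E.
Proof.
move=> p0; case: I => [r||]//=; last by rewrite gt_eqF// ?invr_gt0.
rewrite !lee_fin => r0 rD.
have -> : r = (r `^ p^-1) `^ p by rewrite -powRrM mulVf ?gt_eqF// powRr1.
by apply: ge0_ler_powR; rewrite ?(ltW p0) ?nnegrE ?powR_ge0//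
  (le_trans _ rD) ?powR_ge0.
Qed.

Lemma measurable_borel_fun (g : X -> R) : borel_measurable X ->
  measurable_fun setT (g : g_sigma_algebraType (@open X) -> R) ->
  measurable_fun setT g.
Proof. by move=> bX mg _ Y mY; apply: bX; exact: mg. Qed.

Lemma hajlasz_gradient_small (a rho : R) (u g : X -> R) (N : set X) :
  0 < a -> (forall x, 0 <= g x) ->
  (forall x y, ~ N x -> ~ N y -> `|u x - u y| <= mdist x y `^ a * (g x + g y)) ->
  forall x y, mdist x y <= rho -> ~ N x -> ~ N y ->
    `|u x - u y| <= rho `^ a * (g x + g y).
Proof.
move=> a0 g0 hug x y xy Nx Ny; rewrite (le_trans (hug _ _ Nx Ny))//.
rewrite ler_wpM2r ?addr_ge0// ge0_ler_powR ?nnegrE ?(ltW a0) ?mdist_ge0//.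
by rewrite (le_trans _ xy)// mdist_ge0.
Qed.

End hajlasz.

(** * Compactness of the embedding *)

Section hajlasz_compactness.
Context {R : realType} {d : measure_display} (X : measurableMetricType d R).
Variable mu : {measure set X -> \bar R}.
Hypothesis borelX : borel_measurable X.
Hypothesis boundedX : metric_bounded X.
Hypothesis doublingX : doubling X.
Hypothesis mu_fin : (mu setT < +oo)%E.

Let M := fine (mu setT).

Let muT : mu setT = M%:E.
Proof. by rewrite /M fineK// ge0_fin_numE. Qed.

Let M0 : 0 <= M.
Proof. by rewrite /M fine_ge0. Qed.

(** The infimum over gradients is at most [C]; the slack of 1 provides an actual gradient without
    requiring the infimum to be attained. *)
Lemma hajlasz_norm_gradient (a p C : R) (u : X -> R) : 0 < p -> 0 <= C ->
  (hajlasz_norm mu a p u <= C%:E)%E ->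
  exists g : X -> R, [/\ hajlasz_gradient mu a u g,
    (\int[mu]_x (`|u x| `^ p)%:E <= (C `^ p)%:E)%E &
    (\int[mu]_x (g x `^ p)%:E <= ((C + 1) `^ p)%:E)%E].
Proof.
move=> p0 C0; rewrite /hajlasz_norm; set G := [set _ | _ in _] => hC.
have inf0 : (0 <= ereal_inf G)%E.
  by apply: le_ereal_inf_tmp => _ [g _ <-]; exact: Lnorm_ge0.
have u0 : (0 <= Lp_norm mu p u)%E by exact: Lnorm_ge0.
have int0 (f : X -> R) : (0 <= \int[mu]_x (`|f x| `^ p)%:E)%E.
  by apply: integral_ge0 => x _; rewrite lee_fin powR_ge0.
have hu : (Lp_norm mu p u <= C%:E)%E by apply: le_trans hC; exact: leeDl.
have hinf : (ereal_inf G < (C + 1)%:E)%E.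
  apply: (@le_lt_trans _ _ C%:E); last by rewrite lte_fin ltrDl.
  by apply: le_trans hC; exact: leeDr.
have [_ [g /= hg <-] gC] := ereal_inf_lt hinf.
exists g; split => //.
- by apply: poweR_root_le => //; rewrite -Lp_normE.
- have [g0 _ _] := hg.
  have -> : (\int[mu]_x (g x `^ p)%:E = \int[mu]_x (`|g x| `^ p)%:E)%E.
    by apply: eq_integral => x _; rewrite ger0_norm.
  by apply: poweR_root_le => //; rewrite -Lp_normE ltW.
Qed.

Lemma hajlasz_compact_embedding (a p : R) : 1 <= p -> 0 < a ->
  compact_embedding (hajlasz_space mu a p) (hajlasz_norm mu a p)
                    (Lp_space mu p) (Lp_norm mu p).
Proof.
move=> p1 a0; have p0 : 0 < p by exact: lt_le_trans p1.
split; first by move=> u [].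
move=> u hu [C0 hC0].
pose C := `|C0|.
have C_ge0 : 0 <= C by exact: normr_ge0.
have hC n : (hajlasz_norm mu a p (u n) <= C%:E)%E.
  by rewrite (le_trans (hC0 n))// lee_fin ler_norm.
have mu_ n : measurable_fun setT (u n) by have [/(Lp_spaceP _ _ p0)[]] := hu n.
have /choice[g hg] := fun n => hajlasz_norm_gradient p0 C_ge0 (hC n).
have /choice[N hN] : forall n, exists N : set X, mu.-negligible N /\
    forall x y, ~ N x -> ~ N y ->
      `|u n x - u n y| <= mdist x y `^ a * (g n x + g n y).
  by move=> n; have [[]] := hg n.
have g0 n x : 0 <= g n x by have [[]] := hg n.
have mg n : measurable_fun setT (g n).
  by have [[_ h _] _ _] := hg n; exact: measurable_borel_fun.
pose K := C `^ p + (C + 1) `^ p.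
have K0 : 0 <= K by rewrite addr_ge0 ?powR_ge0.
have hK n : (\int[mu]_x (`|u n x| `^ p + g n x `^ p)%:E <= K%:E)%E.
  have [_ h1 h2] := hg n.
  under eq_integral do rewrite EFinD.
  rewrite ge0_integralD//.
  - by rewrite EFinD leeD.
  - apply: (@measurable_powR_EFin _ _ X setT (fun x => `|u n x|)).
    exact: measurableT_comp.
  - by move=> x _; rewrite lee_fin powR_ge0.
  - exact: measurable_powR_EFin.
pose Q : R := 2 `^ p * 2 `^ p.
have Q0 : 0 < Q by rewrite mulr_gt0 ?powR_gt0.
(* The tolerance under which [rapid_cauchy_Lp_limit] yields a limit. *)
pose e k : R := ((2 ^+ k) `^ p)^-1 * 2^-1 ^+ k.
have e0 k : 0 < e k.
  by rewrite mulr_gt0 ?invr_gt0 ?powR_gt0 ?exprn_gt0 ?invr_gt0.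
pose Phi m n := (\int[mu]_x (`|u m x - u n x| `^ p)%:E)%E.
have [|phi [phi_incr hphi]] := @cauchy_subsequence R Phi e.
  move=> k.
  pose L := K + (K + M).
  have L0 : 0 <= L by rewrite addr_ge0// addr_ge0.
  (* The error has the form [Q * (t * L + (t * L + tau * M))]. The mesh [rho] and the closeness
     [delta] are tuned so that the three terms cost at most a quarter, a quarter and a half of
     [e k]; adding 1 keeps the denominators positive. *)
  pose t := e k / (4 * Q * (L + 1)).
  have t0 : 0 < t by rewrite divr_gt0 ?mulr_gt0// ltr_wpDl.
  pose rho := (t `^ p^-1 / 2) `^ a^-1.
  have rho0 : 0 < rho by rewrite powR_gt0// divr_gt0// powR_gt0.
  have rhot : (2 * rho `^ a) `^ p = t.
    rewrite /rho -powRrM mulVf ?gt_eqF// powRr1 ?divr_ge0 ?powR_ge0//.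
    by rewrite mulrC divfK// -powRrM mulVf ?gt_eqF// powRr1// ltW.
  pose tau := e k / (2 * Q * (M + 1)).
  have tau0 : 0 < tau by rewrite divr_gt0 ?mulr_gt0// ltr_wpDl.
  pose delta := tau `^ p^-1.
  have deltat : delta `^ p = tau.
    by rewrite /delta -powRrM mulVf ?gt_eqF// powRr1// ltW.
  have [n [A [mA tA AT Arho]]] := small_partition borelX boundedX doublingX rho0.
  have /choice[c hc] : forall m, exists c : nat -> R,
      (forall i, `|c i| <= ((K + M) / fine (mu (A i))) `^ p^-1) /\
      (\sum_(0 <= i < n) \int[mu]_(x in A i) (`|u m x - c i| `^ p)%:E <=
        ((2 * rho `^ a) `^ p * (K + (K + M)))%:E)%E.
    move=> m; have [nN hNm] := hN m.
    apply: (@piecewise_constant_approx_partition _ _ _ _ mu_fin n A mA tA AT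
      (N m) (u m) (g m) p (rho `^ a) K p0 (powR_ge0 _ _) nN (mu_ m) (mg m) (g0 m)).
      2: exact: hK.
    move=> i x y Ax Ay; apply: (hajlasz_gradient_small a0 (g0 m) hNm).
    exact: Arho Ax Ay.
  exists n, (fun i m => c m i), (fun i => ((K + M) / fine (mu (A i))) `^ p^-1), delta.
  split; first exact: powR_gt0.
    by move=> i m; have [] := hc m.
  move=> m l hml.
  have [_ cm] := hc m; have [_ cl] := hc l.
  apply: (le_trans (partition_dist_le mu_fin mA tA AT p0 (mu_ m) (mu_ l) cm cl hml)).
  rewrite lee_fin rhot deltat -/Q -/M -/L.
  have hL : Q * (t * L) <= e k / 4.
    rewrite /t [leLHS](_ : _ = (e k / 4) * (L / (L + 1))).
      by rewrite ler_piMr ?divr_ge0 ?ler_pdivrMr ?mul1r ?lerDl// ?ltr_wpDl// ltW.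
    by field; rewrite !gt_eqF// ltr_wpDl.
  have hM : Q * (tau * M) <= e k / 2.
    rewrite /tau [leLHS](_ : _ = (e k / 2) * (M / (M + 1))).
      by rewrite ler_piMr ?divr_ge0 ?ler_pdivrMr ?mul1r ?lerDl// ?ltr_wpDl// ltW.
    by field; rewrite !gt_eqF// ltr_wpDl.
  rewrite (mulrDr Q (t * L)) (mulrDr Q (t * L) (tau * M)).
  by apply: (le_trans (lerD hL (lerD hL hM))); lra.
have [v [mv hv]] := @rapid_cauchy_Lp_limit R d X mu p (fun n => u (phi n)) p0
  (fun n => mu_ (phi n)) (fun k n kn => hphi k k n (leqnn k) kn).
exists phi; split => //; exists v.
  apply/(Lp_spaceP _ _ p0); split => //.
  have [_ uoo] : measurable_fun setT (u (phi 0%N)) /\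
      (\int[mu]_x (`|u (phi 0%N) x| `^ p)%:E < +oo)%E.
    by apply/(Lp_spaceP _ _ p0); have [] := hu (phi 0%N).
  (* [v] is the difference of [u (phi 0)] and [w], whose [p]-th powers have finite integrals, so the
     three-term estimate with zero constants puts [v] in L^p. *)
  pose w x := u (phi 0%N) x - v x.
  have mw : measurable_fun setT w by exact: measurable_funB.
  have cc : `|0 - 0 : R| <= 0 by rewrite subrr normr0.
  have := integral_powR_sub_le mu p0 measurableT (mu_ (phi 0%N)) mw cc.
  under eq_integral do rewrite /w opprB addrC subrK.
  under [X in (_ <= _ * (X + _))%E -> _]eq_integral do rewrite subr0.
  under [X in (_ <= _ * (_ + (X + _)))%E -> _]eq_integral do rewrite subr0.
  move=> /le_lt_trans; apply; rewrite lte_mul_pinfty ?lee_fin ?(ltW Q0)//.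
  apply: lte_add_pinfty; first exact: uoo.
  apply: lte_add_pinfty; last by rewrite muT -EFinM ltry.
  by apply: (le_lt_trans (hv 0%N)); rewrite ltry.
(* The norm is at most the [p]-th root of [e n], hence at most 2^-n. *)
apply: (@squeeze_cvge _ _ _ _ (cst 0%E) _ (fun n => (2^-1 ^+ n)%:E)).
- apply: nearW => n /=; apply/andP; split; first exact: Lnorm_ge0.
  rewrite Lp_normE.
  apply: (@le_trans _ _ ((e n)%:E `^ p^-1)%E).
    apply: gt0_ler_poweR.
    + by rewrite invr_ge0 ltW.
    + by rewrite in_itv /= leey andbT; apply: integral_ge0 => x _;
        rewrite lee_fin powR_ge0.
    + by rewrite in_itv /= leey andbT lee_fin ltW.
    + exact: hv.
  rewrite poweR_EFin lee_fin.
  have -> : 2^-1 ^+ n = ((2^-1 ^+ n) `^ p) `^ p^-1 :> R.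
    by rewrite -powRrM divff ?gt_eqF// powRr1 ?exprn_ge0 ?invr_ge0.
  apply: ge0_ler_powR; rewrite ?invr_ge0 ?nnegrE ?(ltW p0) ?powR_ge0 ?(ltW (e0 n))//.
  have -> : (2^-1 ^+ n) `^ p = ((2 ^+ n) `^ p)^-1 :> R.
    by rewrite exprVn powR_inv// exprn_ge0.
  rewrite /e ler_piMr ?invr_ge0 ?powR_ge0//.
  by rewrite exprn_ile1 ?invr_ge0// invf_le1 ?ler1n.
- exact: cvg_cst.
- apply: cvg_EFin; first exact: nearW.
  by apply: cvg_expr; rewrite ger0_norm ?invr_ge0// invf_lt1 ?ltr1n.
Qed.

(** * Strict inclusion *)

Lemma positive_lower_bound (m : nat -> \bar R) n : (forall i, 0 <= m i)%E ->
  exists2 eta : R, 0 < eta &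
    forall i, (i < n)%N -> m i = 0%E \/ (eta%:E <= m i)%E.
Proof.
move=> m0; elim: n => [|n [eta eta0 h]]; first by exists 1.
have [mn|mn] := eqVneq (m n) 0%E.
  exists eta => // i; rewrite ltnS leq_eqVlt => /predU1P[->|/h//]; by left.
have [r r0 rm] : exists2 r : R, 0 < r & (r%:E <= m n)%E.
  have : (0 < m n)%E by rewrite lt0e mn m0.
  case: (m n) => [r||]//; first by rewrite lte_fin; exists r.
  by exists 1 => //; rewrite leey.
exists (Num.min eta r); first by rewrite lt_min eta0.
move=> i; rewrite ltnS leq_eqVlt => /predU1P[->|/h[|]hi].
- by right; rewrite (le_trans _ rm)// lee_fin ge_min lexx orbT.
- by left.
- by right; rewrite (le_trans _ hi)// lee_fin ge_min lexx.
Qed.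

Lemma hajlasz_neq_Lp (a p : R) : ~ finite_sum_of_atoms mu -> 1 <= p -> 0 < a ->
  hajlasz_space mu a p <> Lp_space mu p.
Proof.
move=> natom p1 a0 HL; have p0 : 0 < p by exact: lt_le_trans p1.
(* This mesh makes (r l ^ a)^p equal to 4^-l, so that the mass 2^-l of the [l]-th peak becomes 2^l
   in the lower bound for the gradient. *)
pose r l : R := (4^-1 ^+ l) `^ (a * p)^-1.
have r0 l : 0 < r l by rewrite powR_gt0// exprn_gt0// invr_gt0.
have rE l : (r l `^ a) `^ p = 4^-1 ^+ l.
  rewrite -powRrM /r -powRrM mulVf ?gt_eqF ?mulr_gt0//.
  by rewrite powRr1// exprn_ge0// invr_ge0.
have /choice[nA hA] : forall l, exists nA : nat * (nat -> set X),
    [/\ forall i, measurable (nA.2 i), trivIset setT nA.2,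
      \big[setU/set0]_(0 <= i < nA.1) nA.2 i = setT &
      forall i x y, nA.2 i x -> nA.2 i y -> mdist x y <= r l].
  move=> l; have [n [A hA]] := small_partition borelX boundedX doublingX (r0 l).
  by exists (n, A).
have /choice[eta heta] : forall l, exists eta : R, 0 < eta /\
    forall i, (i < (nA l).1)%N ->
      mu ((nA l).2 i) = 0%E \/ (eta%:E <= mu ((nA l).2 i))%E.
  move=> l; have [eta eta0 h] := @positive_lower_bound
    (fun i => mu ((nA l).2 i)) (nA l).1 (fun i => measure_ge0 _ _).
  by exists eta.
(* With [S l] of measure at most [eta l / 3] and [V l] at most twice that, each non-null piece keeps
   at least [eta l / 3] outside [V l], as much as it can have inside [S l]. *)
have eta3 l : 0 < eta l / 3 by rewrite divr_gt0//; have [] := heta l.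
have [u [N [S [V [c [mu_ u0 uoo nN hSV]]]]]] := lacunary_function
  (fun delta d0 => exists_small_set mu_fin natom d0) p0 eta3.
have Lu : Lp_space mu p u.
  apply/(Lp_spaceP _ _ p0); split; first exact: mu_.
  by under eq_integral do rewrite ger0_norm//.
move: (Lu); rewrite -HL => -[_ [g [[g0 mg [N' [nN' hug]]] Lg]]].
have {}mg := measurable_borel_fun borelX mg.
have goo : (\int[mu]_x (g x `^ p)%:E < +oo)%E.
  move/(Lp_spaceP _ _ p0) : Lg => [_].
  by under eq_integral do rewrite ger0_norm//.
have lower l : ((4^-1 `^ p * 2 ^+ l)%:E <= \int[mu]_x (g x `^ p)%:E)%E.
  have [mS mV [Seta Veta] [c0 cS] [uS uV]] := hSV l.
  have [mA tA AT Ar] := hA l; have [eta0 etaA] := heta l.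
  have := @gradient_lower_bound R d X mu (nA l).1 (nA l).2 (S l) (V l)
    (N `|` N') u g p (c l) (r l `^ a) p0 c0 (powR_gt0 _ (r0 l)) mA tA AT mS mV
    (negligibleU nN nN') mg g0.
  have -> : (((c l / (4 * r l `^ a)) `^ p)%:E * mu (S l) =
      (4^-1 `^ p * 2 ^+ l)%:E)%E.
    rewrite invfM mulrA powRM ?mulr_ge0 ?invr_ge0 ?powR_ge0 ?(ltW c0)//.
    rewrite powRM ?invr_ge0 ?(ltW c0)// -mulrA mulrC EFinM -muleA cS -EFinM.
    congr EFin; rewrite -mulrA; congr (_ * _).
    rewrite powR_inv ?powR_ge0// rE -exprVn invrK -exprMn.
    by congr (_ ^+ l); field.
  apply.
  - move=> i iN; have mAi := mA i.
    have mAS : measurable ((nA l).2 i `&` S l) by exact: measurableI.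
    have [A0|etaAi] := etaA i iN.
      apply: (@le_trans _ _ (mu ((nA l).2 i))).
        by rewrite le_measure ?inE//; exact: subIsetl.
      by rewrite A0.
    have mAV : measurable ((nA l).2 i `&` V l) by exact: measurableI.
    have mAD : measurable ((nA l).2 i `\` V l) by exact: measurableD.
    have hS : (mu ((nA l).2 i `&` S l) <= (eta l / 3)%:E)%E.
      by apply: le_trans Seta; rewrite le_measure ?inE//; exact: subIsetr.
    have hV : (mu ((nA l).2 i `&` V l) <= (2 * (eta l / 3))%:E)%E.
      by apply: le_trans Veta; rewrite le_measure ?inE//; exact: subIsetr.
    apply: (le_trans hS).
    have fin B : measurable B -> mu B \is a fin_num.
      move=> mB; rewrite ge0_fin_numE// (le_lt_trans _ mu_fin)//.
      by rewrite le_measure ?inE.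
    have AE : mu ((nA l).2 i) =
        (mu ((nA l).2 i `\` V l) + mu ((nA l).2 i `&` V l))%E.
      exact: measureDI.
    move: hV etaAi; rewrite AE.
    rewrite -(fineK (fin _ mAV)) -(fineK (fin _ mAD)) -EFinD !lee_fin.
    by move=> *; lra.
  - by move=> x Sx Nx; apply: uS => // ?; apply: Nx; left.
  - by move=> x Vx Nx; apply: uV => // ?; apply: Nx; left.
  - move=> i x y Ax Ay Nx Ny.
    apply: (hajlasz_gradient_small a0 g0 hug).
    + exact: Ar Ax Ay.
    + by move=> ?; apply: Nx; right.
    + by move=> ?; apply: Ny; right.
have gfin : (\int[mu]_x (g x `^ p)%:E)%E \is a fin_num.
  rewrite ge0_fin_numE//; apply: integral_ge0 => x _.
  by rewrite lee_fin powR_ge0.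
pose k : R := 4^-1 `^ p.
have k0 : 0 < k by rewrite powR_gt0// invr_gt0.
(* [m] exceeds the integral divided by [k], and 2^m exceeds [m], against [lower m]. *)
pose m := (Num.truncn (fine (\int[mu]_x (g x `^ p)%:E)%E / k)).+1.
have := lower m; rewrite -(fineK gfin) lee_fin leNgt -/k => /negP; apply.
rewrite -ltr_pdivrMl// mulrC (lt_le_trans (truncnS_gt _))//.
by rewrite -natrX ler_nat ltnW// ltn_expl.
Qed.

End hajlasz_compactness.

Unset Implicit Arguments.

Theorem proposition1p2 (R : realType) (d : measure_display)
    (X : measurableMetricType d R) (mu : {measure set X -> \bar R})
    (borelX : borel_measurable X)
    (complete_mu : measure_is_complete mu)
    (boundedX : metric_bounded X)
    (doublingX : doubling X)
    (mu_ball : forall (x : X) (r : R), 0 < r ->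
       (0 < mu (ball x r))%E /\ (mu (ball x r) < +oo)%E) :
  (forall p a : R, 1 <= p -> 0 < a ->
     compact_embedding (hajlasz_space mu a p) (hajlasz_norm mu a p)
                       (Lp_space mu p) (Lp_norm mu p)) /\
  (~ finite_sum_of_atoms mu ->
   forall p a : R, 1 <= p -> 0 < a ->
     hajlasz_space mu a p <> Lp_space mu p).
Proof.
(* A bounded nonempty space is a single ball, of finite measure; the empty space has measure 0. *)
have mu_fin : (mu setT < +oo)%E.
  have [[x0]|nX] := pselect (exists x : X, True).
    have [D hD] := boundedX.
    have D0 : 0 < `|D| + 1 by rewrite ltr_pwDr.
    suff <- : ball x0 (`|D| + 1) = setT by have [] := mu_ball x0 _ D0.
    rewrite -subTset => x _; rewrite ballEmdist /= (le_lt_trans (hD _ _))//.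
    by rewrite (le_lt_trans (ler_norm _))// ltrDl.
  suff -> : [set: X] = set0 by rewrite measure0.
  by rewrite -subset0 => x _; apply: nX; exists x.
split=> [p a p1 a0|natom p a p1 a0].
  exact: hajlasz_compact_embedding.
exact: hajlasz_neq_Lp.
Qed.
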